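(* Let $B$ be a group, let $\varphi,\psi:B\to B$ be two left averaging operators on $B$, and assume that $\ker(\psi)\neq\varnothing$. Let $+$ and $\circ$ be the operations on $B$ induced by $\varphi$ and $\psi$ respectively, i.e., $a+b=\varphi(a)b$ and $a\circ b=\psi(a)b$ for all $a,b\in B$. Then the structure $(B,+,\circ)$ is a left $RG$-semibrace if and only if $$\psi(a)\varphi(b)=\varphi\left(\psi(a)b\right)\varphi(a)^{-1}\psi(a)$$ holds for all $a,b\in B$.
   Context: The group $B$ is written multiplicatively with identity $1_B$. A left averaging operator on a group $B$ is a map $\varphi:B\to B$ such that $\varphi(a)\varphi(b)=\varphi(\varphi(a)b)$ for all $a,b\in B$. For such a map (not necessarily a homomorphism), $\ker(\varphi):=\{a\in B\mid \varphi(a)=1_B\}$. A right group is a non-empty semigroup $(S,\cdot)$ such that for all $a,b\in S$ there is a unique $x\in S$ with $a\cdot x=b$. A left $RG$-semibrace is a triplet $(B,+,\circ)$ where $+,\circ$ are binary operations on the set $B$ such that $(B,+)$ and $(B,\circ)$ are both right groups and $a\circ(b+c)=a\circ b+(-a+a\circ c)$ for all $a,b,c\in B$, where $-a+a\circ c$ denotes the unique $x\in B$ such that $a+x=a\circ c$. *)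

(* Defs.v *)
From mathcomp Require Import all_boot.

Set Implicit Arguments.
Unset Strict Implicit.
Unset Printing Implicit Defensive.

Local Open Scope group_scope.

Record right_group (T : Type) (op : T -> T -> T) : Prop := RightGroup {
  right_group_inhabited : inhabited T;
  right_group_assoc : associative op;
  right_group_ldiv : forall a b : T, exists! x : T, op a x = b
}.

(* In the last field, x is the element written -a + a o c: since (T, +) is a
   right group, there is exactly one x such that a + x = a o c. *)
Record left_RG_semibrace (T : Type) (add circ : T -> T -> T) : Prop :=
  LeftRGSemibrace {
    semibrace_add : right_group add;
    semibrace_circ : right_group circ;
    semibrace_distr : forall a b c x : T, add a x = circ a c ->
      circ a (add b c) = add (circ a b) x
  }.

Definition left_averaging (B : groupType) (phi : B -> B) : Prop :=
  forall a b : B, phi a * phi b = phi (phi a * b).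

(* phi need not be a morphism, so this set may be empty. *)
Definition op_ker (B : groupType) (phi : B -> B) : B -> Prop :=
  fun a => phi a = 1.

Definition induced_op (B : groupType) (phi : B -> B) : B -> B -> B :=
  fun a b => phi a * b.

(* Main.v *)
Require Import Defs.
From mathcomp Require Import all_boot.

(** An operation of the form [a, b |-> phi a * b] is left translation by
    [phi a] in the group, so left division always exists and is unique, and
    the averaging identity is exactly what associativity asks for.  Hence both
    induced operations are right groups ([induced_op_right_group]), and being
    a semibrace amounts to the distributivity law.  The element [-a + a o c] is
    [(phi a)^-1 * psi a * c], so that law reads
    [psi a * phi b * c = phi (psi a * b) * (phi a)^-1 * psi a * c]; the factor
    [c] cancels, which leaves the stated identity. *)

Local Open Scope group_scope.

Lemma induced_op_right_group (B : groupType) (phi : B -> B) :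
  left_averaging phi -> right_group (induced_op phi).
Proof.
move=> hphi; rewrite /induced_op; split.
- exact: inhabits 1.
- by move=> a b c; rewrite mulgA hphi.
- move=> a b; exists ((phi a)^-1 * b); split; first by rewrite mulVKg.
  by move=> x <-; rewrite mulKg.
Qed.

Theorem theorem2p2 (B : groupType) (phi psi : B -> B)
  (hphi : left_averaging phi) (hpsi : left_averaging psi)
  (hker : exists a : B, op_ker psi a) :
  left_RG_semibrace (induced_op phi) (induced_op psi) <->
  (forall a b : B,
     psi a * phi b = phi (psi a * b) * (phi a)^-1 * psi a).
Proof.
split=> [[_ _ distr] a b | twist].
- (* Distributivity at [c = 1], where [-a + a o c] is [(phi a)^-1 * psi a]. *)
  have := distr a b 1 ((phi a)^-1 * psi a).
  by rewrite /induced_op !mulg1 mulVKg mulgA => ->.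
- split; [exact: induced_op_right_group | exact: induced_op_right_group |].
  rewrite /induced_op => a b c x def_x.
  have -> : x = (phi a)^-1 * (psi a * c) by rewrite -def_x mulKg.
  by rewrite !mulgA twist.
Qed.
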